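(* Let $G$ be an ordered group with identity $e$ and let $K\le G$ be a subgroup. Then $K$ is a module of $G$ if and only if either (a) $K$ is the strong subgroup determined by an initial segment of $\mathcal V(G)$, that is, $K=\{e\}\cup\bigcup_{H\in I}H$ for some initial segment $I$ of $\mathcal V(G)$; or (b) there is a unique $H\in\mathcal V(G)$ such that $H^-<K<H$ (strict inclusions) and $K/H^-$ is a subgroup-module of $Q_H=H/H^-$. Let $\mathsf{MSub}(G):=\{K\le G: K\text{ is a module of the underlying ordered set of }G\}$, ordered by inclusion. Consequently, for every $H\in\mathcal V(G)$, $$[H^-,H]_{\mathsf{MSub}(G)}\cong\begin{cases}\mathbf 2,& Q_H\text{ prime},\\ \operatorname{ConvSub}(Q_H),& Q_H\text{ totally ordered},\\ \operatorname{Sub}(Q_H),& Q_H\text{ equality-ordered}.\end{cases}$$ Moreover, $\mathsf{MSub}(G)$ is a complete sublattice of the lattice $\operatorname{Sub}(G)$ of all subgroups of $G$.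
   Context: An ordered group is a group $G$ (identity $e$) equipped with a partial order $\le$ such that $x\le y$ implies $axb\le ayb$ for all $a,b,x,y\in G$. A module of a poset $(X,\le)$ is a subset $M\subseteq X$ such that for every $x\in X\setminus M$ and all $m,m'\in M$: $x\le m\iff x\le m'$ and $m\le x\iff m'\le x$. The empty set, singletons and $X$ are the trivial modules; the poset is prime if it has no other module. A module $M$ is strong if it is nonempty and every module is disjoint from $M$, contained in $M$, or contains $M$. $S(x,y)$ denotes the least strong module containing $x$ and $y$. Modules of an ordered group are modules of its underlying poset. A subgroup-module of an ordered group is a subgroup that is a module. For an ordered group $G$ put $\mathcal V(G):=\{S(e,g):g\ne e\}$ and, for $H\in\mathcal V(G)$, $H^-:=\{e\}\cup\bigcup\{L\in\mathcal V(G):L\subsetneq H\}$. It is known that $\mathcal V(G)$ is a chain (under inclusion) of convex subgroups, that $H^-$ is a proper convex normal subgroup of $H$ for every $H\in\mathcal V(G)$, and that the quotient ordered group $Q_H:=H/H^-$ (ordered by $\alpha\le\beta$ iff $a\le b$ for some $a\in\alpha,b\in\beta$) is prime, totally ordered, or equality-ordered (the order is equality). An initial segment of a chain is a downward closed subset, possibly empty. $\operatorname{Sub}(Q)$ is the lattice of all subgroups of $Q$, $\operatorname{ConvSub}(Q)$ the lattice of convex subgroups of the ordered group $Q$, $\mathbf 2$ the two-element chain, and $[H^-,H]_{\mathsf{MSub}(G)}=\{K\in\mathsf{MSub}(G):H^-\le K\le H\}$; $\cong$ is isomorphism of ordered sets. A complete sublattice is a subset closed under arbitrary meets and joins of the ambient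 complete lattice. *)

(* Defs.v *)
From HB Require Import structures.
From mathcomp Require Import all_boot all_order.
From mathcomp Require Import boolp classical_sets.

Set Implicit Arguments.
Unset Strict Implicit.
Unset Printing Implicit Defensive.

Import Order.TTheory.
Local Open Scope group_scope.
Local Open Scope order_scope.
Local Open Scope classical_set_scope.

Section PosetModules.
Context {d : Order.disp_t} {X : porderType d}.
Implicit Types (M N : set X) (x y m : X).

Definition is_module M : Prop :=
  forall x, ~ M x -> forall m m', M m -> M m' ->
    (x <= m) = (x <= m') /\ (m <= x) = (m' <= x).

Definition trivial_module M : Prop :=
  [\/ M = set0, exists x, M = [set x] | M = setT].

Definition strong_module M : Prop :=
  [/\ M !=set0, is_module M &
      forall N, is_module N -> [\/ N `&` M = set0, N `<=` M | M `<=` N]].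

Definition least_strong_module x y : set X :=
  smallest strong_module [set x; y].

Definition convex M : Prop :=
  forall x y z, M x -> M z -> x <= y -> y <= z -> M y.

End PosetModules.

Definition prime_poset {d} (X : porderType d) : Prop :=
  forall M : set X, is_module M -> trivial_module M.

Definition totally_ordered {d} (X : porderType d) : Prop :=
  total (<=%O : rel X).

Definition equality_ordered {d} (X : porderType d) : Prop :=
  forall x y : X, x <= y -> x = y.

Definition poset_iso {d d'} (X : porderType d) (Y : porderType d') : Prop :=
  exists2 f : X -> Y, bijective f & {mono f : x y / x <= y}.

(* Suprema and infima are those of the ambient poset [X]; the empty family is
   included, so [S] has to contain the bottom and the top of [X]. *)
Definition complete_sublattice {d} {X : porderType d} (S : set X) : Prop :=
  forall A : set X, A `<=` S ->
    (exists2 s, supremums A s & S s) /\ (exists2 i, infimums A i & S i).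

(* A family of elements of a poset, as a type, is ordered as in the poset.  On
   [set T] the order is inclusion. *)
HB.instance Definition _ {T : choiceType} (A : set T) :=
  SubChoice.copy (set_type A) {x : T | x \in A}.
HB.instance Definition _ {d} {X : porderType d} (A : set X) :=
  [SubChoice_isSubPOrder of set_type A by <: with d].

HB.mixin Record isOrderedGroup (d : Order.disp_t) G
    of Group G & Order.POrder d G := {
  le_mulg2 : forall a b x y : G, x <= y -> a * x * b <= a * y * b
}.

#[short(type="orderedGroupType")]
HB.structure Definition OrderedGroup d :=
  {G of isOrderedGroup d G & Group G & Order.POrder d G}.

Definition is_subgroup {G : groupType} (K : set G) : Prop :=
  [/\ K 1, forall x y, K x -> K y -> K (x * y) & forall x, K x -> K x^-1].

Definition Subgroups (G : groupType) : Type :=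
  set_type [set K : set G | is_subgroup K].

HB.instance Definition _ (G : groupType) := Order.POrder.on (Subgroups G).

Section OrderedGroupDefs.
Context {d : Order.disp_t} (G : orderedGroupType d).

Definition MSub : set (Subgroups G) := [set K | is_module (val K)].

Definition ConvSub : set (Subgroups G) := [set K | convex (val K)].

Definition Vset : set (set G) :=
  [set least_strong_module 1 g | g in [set g : G | g != 1]].

Definition Vminus (H : set G) : set G :=
  [set 1] `|` \bigcup_(L in [set L | Vset L /\ L `<` H]) L.

Definition initial_segment (I : set (set G)) : Prop :=
  I `<=` Vset /\ forall L H, Vset L -> I H -> L `<=` H -> I L.

Definition MSub_interval (H : set G) : set (Subgroups G) :=
  [set K | [/\ MSub K, Vminus H `<=` val K & val K `<=` H]].

End OrderedGroupDefs.

Arguments MSub {d} G _.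
Arguments ConvSub {d} G _.
Arguments Vset {d} G _.

Definition is_subgroup_module {d} {G : orderedGroupType d} (K : set G) : Prop :=
  is_subgroup K /\ is_module K.

(** [Vset G] is a chain of convex subgroups and [Vminus H] is a convex normal
    subgroup of [H] for [H] in [Vset G]; these facts make the quotient [factor]
    below an ordered group. *)

Section StrongModules.
Context {d : Order.disp_t} {X : porderType d}.
Implicit Types M N : set X.

Lemma least_strong_module_strong (x y : X) :
  strong_module (least_strong_module x y).
Proof.
rewrite /least_strong_module; set S := smallest _ _; split.
- by exists x; apply: sub_gen_smallest; left.
- move=> z nSz m m' Sm Sm'.
  have [M [[Ms xyM] nMz]] :
      exists M, (strong_module M /\ [set x; y] `<=` M) /\ ~ M z.
    apply: contrapT => nex; apply: nSz => M Mxy; apply: contrapT => nMz.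
    by apply: nex; exists M.
  case: (Ms) => _ modM _.
  by apply: (modM z nMz m m'); [apply: Sm | apply: Sm'].
- move=> N modN.
  have [allN|] := pselect (forall M, strong_module M /\ [set x; y] `<=` M ->
    N `<=` M).
    by apply: Or32 => z Nz M /allN; apply.
  move=> /existsNP[M /not_implyP[[Ms xyM] nNM]].
  have SM : S `<=` M by apply: smallest_sub.
  case: Ms => _ _ /(_ _ modN)[NM|//|MN].
  + apply: Or31; apply/seteqP; split=> // z [Nz Sz]; rewrite -NM.
    by split=> //; exact: SM.
  + by apply: Or33 => z /SM /MN.
Qed.

Lemma strong_module_comparable M N (x : X) :
  strong_module M -> strong_module N -> M x -> N x -> M `<=` N \/ N `<=` M.
Proof.
move=> [_ modM _] [_ _ /(_ _ modM)[NM0|MN|NM]] Mx Nx; [|by left|by right].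
by have : (M `&` N) x by []; rewrite NM0.
Qed.

Variables (f g : X -> X).
Hypotheses (fK : cancel f g) (gK : cancel g f).

Lemma module_preimage M :
  (forall x y, (f x <= f y) = (x <= y)) \/
  (forall x y, (f x <= f y) = (y <= x)) ->
  is_module M -> is_module (f @^-1` M).
Proof.
move=> mon modM x nMx m m' Mm Mm'.
by have := modM _ nMx _ _ Mm Mm'; case: mon => mon; rewrite !mon => -[-> ->].
Qed.

Lemma strong_module_preimage M :
  (forall x y, (f x <= f y) = (x <= y)) \/
  (forall x y, (f x <= f y) = (y <= x)) ->
  strong_module M -> strong_module (f @^-1` M).
Proof.
move=> mon [[x Mx] modM strM]; split.
- by exists (g x); rewrite /preimage /= gK.
- exact: module_preimage.
- move=> N modN.
  have modN' : is_module (g @^-1` N).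
    move=> y nNy m m' Nm Nm'; have := modN _ nNy _ _ Nm Nm'.
    have mong : (forall u v, (g u <= g v) = (u <= v)) \/
                (forall u v, (g u <= g v) = (v <= u)).
      by case: mon => mon; [left | right] => u v; rewrite -mon !gK.
    by case: mong => mong; rewrite !mong => -[-> ->].
  case: (strM _ modN') => [NM0|NM|MN].
  + apply: Or31; apply/seteqP; split=> // y [Ny My].
    have : (g @^-1` N `&` M) (f y) by split=> //; rewrite /preimage /= fK.
    by rewrite NM0.
  + by apply: Or32 => y Ny; apply: NM; rewrite /preimage /= fK.
  + by apply: Or33 => y /MN; rewrite /preimage /= fK.
Qed.

End StrongModules.

Section Factor.
Context {d : Order.disp_t} {G : orderedGroupType d}.
Implicit Types (x y z : G) (M : set G).

Lemma le_mulg2l a x y : (a * x <= a * y) = (x <= y).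
Proof.
apply/idP/idP => [/(le_mulg2 a^-1 1)|/(le_mulg2 a 1)]; rewrite !mulg1 //.
by rewrite !mulKg.
Qed.

Lemma le_mulg2r a x y : (x * a <= y * a) = (x <= y).
Proof.
apply/idP/idP => [/(le_mulg2 1 a^-1)|/(le_mulg2 1 a)]; rewrite !mul1g //.
by rewrite !mulgK.
Qed.

Lemma le_invg x y : (x^-1 <= y^-1) = (y <= x).
Proof. by rewrite -(le_mulg2l x x^-1) mulgV -(le_mulg2r y 1) mulgVK mul1g. Qed.

Lemma strong_translate a M :
  strong_module M -> strong_module [set x | M (a * x)].
Proof.
move=> Ms; apply: (@strong_module_preimage _ _ _ ( *%g a^-1)) => //.
- exact: mulKg.
- exact: mulVKg.
- by left=> x y; exact: le_mulg2l.
Qed.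

Lemma strong_inv M : strong_module M -> strong_module [set x | M x^-1].
Proof.
move=> Ms; apply: (@strong_module_preimage _ _ _ (@inv G)) => //;
  [exact: invgK | exact: invgK | by right=> x y; exact: le_invg].
Qed.

Lemma strong_conj a M :
  strong_module M -> strong_module [set x | M (x ^ a)].
Proof.
move=> Ms.
apply: (@strong_module_preimage _ _ (conjg^~ a) (conjg^~ a^-1)) => //.
- exact: conjgK.
- exact: conjgKV.
- by left=> x y; rewrite /conjg le_mulg2l le_mulg2r.
Qed.

Lemma strong_subgroup M : strong_module M -> M 1 -> is_subgroup M.
Proof.
move=> Ms M1.
have invM x : M x -> M x^-1.
  have [] := @strong_module_comparable _ _ _ _ 1 Ms (strong_inv Ms) M1.
  - by rewrite /= invg1.
  - by move=> MMV /MMV.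
  - by move=> MVM Mx; apply: MVM; rewrite /= invgK.
have divM x y : M x -> M y -> M (x^-1 * y).
  move=> Mx My.
  have xs := strong_translate x^-1 Ms; have ys := strong_translate y^-1 Ms.
  have [] := @strong_module_comparable _ _ _ _ 1 xs ys.
  - by rewrite /= mulg1; exact: invM.
  - by rewrite /= mulg1; exact: invM.
  - by move=> /(_ x); rewrite /= mulVg => /(_ M1)/invM; rewrite invgM invgK.
  - by move=> /(_ y); rewrite /= mulVg => /(_ M1).
by split=> // x y Mx My; rewrite -[x]invgK; apply: divM => //; exact: invM.
Qed.

Lemma module_convex M : is_module M -> convex M.
Proof.
move=> modM x y z Mx Mz xy yz; apply: contrapT => nMy.
have [_ eqy] := modM _ nMy _ _ Mx Mz; rewrite xy in eqy.
by apply: nMy; rewrite (@le_anti _ _ y z) ?yz -?eqy.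
Qed.

Lemma Vset_strong H : Vset G H -> strong_module H.
Proof. by move=> [g _ <-]; exact: least_strong_module_strong. Qed.

Lemma Vset1 H : Vset G H -> H (1 : G).
Proof. by move=> [g _ <-]; apply: sub_gen_smallest; left. Qed.

Lemma Vset_subgroup H : Vset G H -> is_subgroup H.
Proof. by move=> VH; apply: strong_subgroup; [exact: Vset_strong|exact: Vset1]. Qed.

Lemma Vset_convex H : Vset G H -> convex H.
Proof. by move=> /Vset_strong[_ + _]; exact: module_convex. Qed.

Lemma Vset_chain H L : Vset G H -> Vset G L -> H `<=` L \/ L `<=` H.
Proof.
move=> VH VL.
by apply: (@strong_module_comparable _ _ _ _ 1);
  [exact: Vset_strong|exact: Vset_strong|exact: Vset1|exact: Vset1].
Qed.

Lemma Vset_conj a H : Vset G H -> Vset G [set x : G | H (x ^ a)].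
Proof.
move=> [g g1 <-]; exists (g ^ a^-1).
  by apply: contra_neq g1 => /(congr1 (conjg^~ a)); rewrite conjgKV conj1g.
apply/seteqP; split.
  apply: smallest_sub.
    exact: strong_conj (least_strong_module_strong _ _).
  move=> x [->|->] /=; rewrite ?conjgKV ?conj1g; apply: sub_gen_smallest.
    by left.
  by right.
move=> x /= Sx; rewrite -(conjgK a x).
have : [set y | least_strong_module 1 (g ^ a^-1) (y ^ a^-1)] (x ^ a).
  apply: Sx; split.
    exact: strong_conj (least_strong_module_strong _ _).
  move=> y [->|->] /=; rewrite ?conj1g; apply: sub_gen_smallest.
    by left.
  by right.
by [].
Qed.

Lemma Vminus_sub H : Vset G H -> Vminus H `<=` H.
Proof. by move=> VH x [->|[L [_ [LH _]] /LH//]]; exact: Vset1. Qed.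

Lemma Vminus_proper H : Vset G H -> Vminus H `<` H.
Proof.
move=> VH; split; first exact: Vminus_sub.
move: (VH) => [g g1 HE].
have Hg : H g by rewrite -HE; apply: sub_gen_smallest; right.
move=> /(_ _ Hg)[/= gE|[L [VL [LH nHL]] Lg]]; first by move: g1; rewrite /= gE eqxx.
apply: nHL; rewrite -HE; apply: smallest_sub; first exact: Vset_strong.
by move=> x [->|->] //; exact: Vset1.
Qed.

Lemma Vminus2 H x y : Vset G H -> Vminus H x -> Vminus H y ->
  x = 1 /\ y = 1 \/ exists2 L, Vset G L /\ L `<` H & L x /\ L y.
Proof.
move=> VH [->|[L LH Lx]] [->|[K KH Ky]].
- by left.
- by right; exists K => //; split=> //; apply: Vset1 KH.1.
- by right; exists L => //; split=> //; apply: Vset1 LH.1.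
have [LK|KL] := Vset_chain LH.1 KH.1; right.
- by exists K => //; split=> //; exact: LK.
- by exists L => //; split=> //; exact: KL.
Qed.

Lemma Vminus_subgroup H : Vset G H -> is_subgroup (Vminus H).
Proof.
move=> VH; split; first by left.
- move=> x y Mx My; have [[-> ->]|[L LH [Lx Ly]]] := Vminus2 VH Mx My.
    by rewrite mulg1; left.
  by right; exists L => //; have [_ + _] := Vset_subgroup LH.1; apply.
- move=> x [->|[L LH Lx]]; first by rewrite invg1; left.
  by have [_ _ invL] := Vset_subgroup LH.1; right; exists L => //; exact: invL.
Qed.

Lemma Vminus_convex H : Vset G H -> convex (Vminus H).
Proof.
move=> VH x y z Mx Mz; have [[-> ->]|[L LH [Lx Lz]]] := Vminus2 VH Mx Mz.
  by move=> y1 y2; left; apply: le_anti; rewrite y1 y2.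
by move=> xy yz; right; exists L => //; exact: Vset_convex LH.1 _ _ _ Lx Lz xy yz.
Qed.

Lemma Vminus_normal H a x : Vset G H -> H a -> Vminus H x -> Vminus H (x ^ a).
Proof.
move=> VH Ha [->|[L [VL [LH nHL]] Lx]]; first by rewrite conj1g; left.
have [_ mulH invH] := Vset_subgroup VH.
have conjH b y : H b -> H y -> H (y ^ b).
  by move=> Hb Hy; apply: (mulH); [exact: invH|exact: mulH].
right; exists [set y | L (y ^ a^-1)]; last by rewrite /= conjgK.
split; first exact: Vset_conj.
split=> [y /= /LH Hy|HL].
  by rewrite -(conjgKV a y); exact: conjH.
apply: nHL => y Hy; rewrite -(conjgK a y).
by apply: HL; exact: conjH.
Qed.


(* The quotient [H / Vminus H], whose elements are the cosets [x * Vminus H] for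
   [x] in [H], as subsets of [G]. *)

Definition coset H x : set G := [set x * n | n in Vminus H].

Record factor (H : Vset G) := Factor {
  coset_of :> set G;
  coset_ofP : [set coset (val H) x | x in val H] coset_of
}.

Variable H : Vset G.
Implicit Types q r : factor H.

HB.instance Definition _ := gen_eqMixin (factor H).
HB.instance Definition _ := gen_choiceMixin (factor H).

Let VH : Vset G (val H) := set_mem (valP H).
Let N := Vminus (val H).

Definition factor_proj x (Hx : val H x) : factor H :=
  @Factor H (coset (val H) x) (ex_intro2 _ _ x Hx erefl).

Lemma factor_inj q r : coset_of q = coset_of r -> q = r.
Proof.
case: q r => [A HA] [B HB] /= AB; rewrite -AB in HB *.
by rewrite (Prop_irrelevance HA HB).
Qed.

Lemma factor_projP q : exists x (Hx : val H x), q = factor_proj Hx.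
Proof.
by have [x Hx qE] := coset_ofP q; exists x, Hx; exact: factor_inj.
Qed.

Lemma coset_id x : coset (val H) x x.
Proof. by exists 1; rewrite ?mulg1 //; left. Qed.

Lemma Vset_valM x y : val H x -> val H y -> val H (x * y).
Proof. by have [_ + _] := Vset_subgroup VH; apply. Qed.

Lemma Vset_valV x : val H x -> val H x^-1.
Proof. by have [_ _ +] := Vset_subgroup VH; apply. Qed.

Lemma Vset_val1 : val H 1.
Proof. exact: Vset1 VH. Qed.

Definition factor_one : factor H := factor_proj Vset_val1.

Lemma coset_mul x y : val H x -> val H y ->
  [set a * b | a in coset (val H) x & b in coset (val H) y] =
  coset (val H) (x * y).
Proof.
have [N1 Nm Ni] := Vminus_subgroup VH.
move=> Hx Hy; apply/seteqP; split.
  move=> _ [_ [n Nn <-] [_ [m Nm' <-] <-]]; exists (n ^ y * m).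
    by apply: Nm => //; exact: Vminus_normal.
  by rewrite /conjg !mulgA mulgK.
move=> _ [n Nn <-]; exists x; first exact: coset_id.
by exists (y * n); [exists n|rewrite mulgA].
Qed.

Lemma coset_inv x : val H x ->
  [set a^-1 | a in coset (val H) x] = coset (val H) x^-1.
Proof.
have [N1 Nm Ni] := Vminus_subgroup VH.
move=> Hx; apply/seteqP; split.
  move=> _ [_ [n Nn <-] <-]; exists (n^-1 ^ x^-1).
    by apply: Vminus_normal; [exact: VH|exact: Vset_valV|exact: Ni].
  by rewrite /conjg invgK invgM !mulgA mulVg mul1g.
move=> _ [n Nn <-]; exists (x * (n^-1 ^ x)).
  by exists (n^-1 ^ x) => //; apply: Vminus_normal => //; exact: Ni.
by rewrite /conjg mulVKg invgM invgK.
Qed.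

Lemma factor_mul_subproof q r :
  [set coset (val H) x | x in val H] [set a * b | a in q & b in r].
Proof.
have [[x Hx <-] [y Hy <-]] := (coset_ofP q, coset_ofP r).
by exists (x * y); [exact: Vset_valM|rewrite coset_mul].
Qed.

Definition factor_mul q r : factor H := Factor (factor_mul_subproof q r).

Lemma factor_inv_subproof q :
  [set coset (val H) x | x in val H] [set a^-1 | a in q].
Proof.
have [x Hx <-] := coset_ofP q.
by exists x^-1; [exact: Vset_valV|rewrite coset_inv].
Qed.

Definition factor_inv q : factor H := Factor (factor_inv_subproof q).

Lemma factor_projM x y (Hx : val H x) (Hy : val H y) :
  factor_mul (factor_proj Hx) (factor_proj Hy) = factor_proj (Vset_valM Hx Hy).
Proof. by apply: factor_inj; exact: coset_mul. Qed.

Lemma factor_projV x (Hx : val H x) :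
  factor_inv (factor_proj Hx) = factor_proj (Vset_valV Hx).
Proof. by apply: factor_inj; exact: coset_inv. Qed.

Lemma factor_proj_eq x y (Hx : val H x) (Hy : val H y) :
  x = y -> factor_proj Hx = factor_proj Hy.
Proof. by move=> xy; apply: factor_inj; rewrite /= xy. Qed.

Lemma factor_mulA : associative factor_mul.
Proof.
move=> q r s.
have [[x [Hx ->]] [y [Hy ->]]] := (factor_projP q, factor_projP r).
have [z [Hz ->]] := factor_projP s.
by rewrite !factor_projM; apply: factor_proj_eq; rewrite mulgA.
Qed.

Lemma factor_mul1 : left_id factor_one factor_mul.
Proof.
move=> q; have [x [Hx ->]] := factor_projP q.
by rewrite factor_projM; apply: factor_proj_eq; rewrite mul1g.
Qed.

Lemma factor_1mul : right_id factor_one factor_mul.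
Proof.
move=> q; have [x [Hx ->]] := factor_projP q.
by rewrite factor_projM; apply: factor_proj_eq; rewrite mulg1.
Qed.

Lemma factor_mulV : left_inverse factor_one factor_inv factor_mul.
Proof.
move=> q; have [x [Hx ->]] := factor_projP q.
by rewrite factor_projV factor_projM; apply: factor_proj_eq; rewrite mulVg.
Qed.

Lemma factor_Vmul : right_inverse factor_one factor_inv factor_mul.
Proof.
move=> q; have [x [Hx ->]] := factor_projP q.
by rewrite factor_projV factor_projM; apply: factor_proj_eq; rewrite mulgV.
Qed.

HB.instance Definition _ := isGroup.Build (factor H)
  factor_mulA factor_mul1 factor_1mul factor_mulV factor_Vmul.

Definition factor_le q r : bool :=
  `[< exists a b, [/\ coset_of q a, coset_of r b & a <= b] >].

Lemma factor_leP x y (Hx : val H x) (Hy : val H y) :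
  factor_le (factor_proj Hx) (factor_proj Hy) <-> exists2 n, N n & x <= y * n.
Proof.
have [N1 Nm Ni] := Vminus_subgroup VH.
rewrite /factor_le asboolE; split.
  move=> [_ [_ [[n Nn <-] [m Nm' <-] xy]]]; exists (m * n^-1).
    by apply: (Nm) => //; exact: Ni.
  by rewrite -(le_mulg2r n) !mulgA mulgVK.
move=> [n Nn xy]; exists x, (y * n); split => //; first exact: coset_id.
by exists n.
Qed.

Lemma factor_le_refl : reflexive factor_le.
Proof.
move=> q; have [x [Hx ->]] := factor_projP q.
by apply/factor_leP; exists 1; rewrite ?mulg1 //; left.
Qed.

Lemma factor_le_anti : antisymmetric factor_le.
Proof.
have [N1 Nm Ni] := Vminus_subgroup VH.
move=> q r; have [[x [Hx ->]] [y [Hy ->]]] := (factor_projP q, factor_projP r).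
move=> /andP[/factor_leP[n Nn xy] /factor_leP[m Nm' yx]].
have Nxy : N (y^-1 * x).
  apply: (Vminus_convex VH (x := m^-1) (z := n)) => //; first exact: Ni.
    by rewrite -(le_mulg2l y) mulVKg -(le_mulg2r m) mulgVK.
  by rewrite -(le_mulg2l y) mulVKg.
apply: factor_inj; apply/seteqP; split=> _ [p Np <-].
  by exists (y^-1 * x * p); [exact: Nm|rewrite !mulgA mulgV mul1g].
exists ((y^-1 * x)^-1 * p); first by apply: (Nm) => //; exact: Ni.
by rewrite invgM invgK !mulgA mulgV mul1g.
Qed.

Lemma factor_le_trans : transitive factor_le.
Proof.
have [N1 Nm Ni] := Vminus_subgroup VH.
move=> r q s; have [[x [Hx ->]] [y [Hy ->]]] := (factor_projP q, factor_projP r).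
have [z [Hz ->]] := factor_projP s.
move=> /factor_leP[n Nn xy] /factor_leP[m Nm' yz]; apply/factor_leP.
exists (m * n); first exact: Nm.
by apply: le_trans xy _; rewrite mulgA le_mulg2r.
Qed.

HB.instance Definition _ := Order.Le_isPOrder.Build d (factor H)
  factor_le_refl factor_le_anti factor_le_trans.

Lemma factor_le_mulg2 (p s q r : factor H) : q <= r -> p * q * s <= p * r * s.
Proof.
move=> /asboolP[a [b [qa rb ab]]].
have [[x Hx pE] [y Hy sE]] := (coset_ofP p, coset_ofP s).
apply/asboolP; exists (x * a * y), (x * b * y).
have px : coset_of p x by rewrite -pE; exact: coset_id.
have sy : coset_of s y by rewrite -sE; exact: coset_id.
by split; [do 2![eexists; eauto]|do 2![eexists; eauto]|exact: le_mulg2].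
Qed.

HB.instance Definition _ := isOrderedGroup.Build d (factor H) factor_le_mulg2.

Definition factor_image (K : set G) : set (factor H) :=
  [set q | exists2 x, K x & coset_of q = coset (val H) x].


End Factor.

Arguments factor_image {d G} H K _.

(* Main.v *)
(** Distinct cosets of [Vminus H] in [H] compare as their representatives do,
    because [Vminus H] is a module; so taking the quotient by [Vminus H] matches
    the subgroup-modules between [Vminus H] and [H] with those of [factor H].
    A subgroup-module [K] is comparable to every member of [Vset G], since these
    are strong.  If [K] is not the union of the members it contains, some [g] in
    [K] has [H := S(1, g)] not included in [K]; then [K] is strictly below [H],
    and every member strictly below [H] misses [g], hence lies in [K]. *)

Require Import Defs.
From mathcomp Require Import all_boot all_order.
From mathcomp Require Import boolp classical_sets.

Local Open Scope group_scope.
Local Open Scope order_scope.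
Local Open Scope classical_set_scope.

(** * Closure properties of modules, and modules of total and equality orders *)

Section Modules.
Context {d : Order.disp_t} {X : porderType d}.
Implicit Types (M : set X) (F : set (set X)).

(** Comparing every [m] with one base point [c] suffices, since [m] and [m'] then both agree with
    [c]. In subgroups the base point will be [1]. *)
Lemma module_pointed M c : M c ->
  (forall x, ~ M x -> forall m, M m ->
    (x <= m) = (x <= c) /\ (m <= x) = (c <= x)) ->
  is_module M.
Proof.
move=> Mc h x nMx m m' Mm Mm'.
by have [[-> ->] [-> ->]] := (h x nMx m Mm, h x nMx m' Mm').
Qed.

Lemma module_setT : is_module (setT : set X).
Proof. by move=> x /(_ I). Qed.

Lemma module_set1 c : is_module [set c : X].
Proof. by move=> x _ m m' -> ->. Qed.

Lemma module_bigcap F : (forall M, F M -> is_module M) ->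
  is_module (\bigcap_(M in F) M).
Proof.
move=> modF x /existsNP[M /not_implyP[FM nMx]] m m' Im Im'.
by apply: (modF M FM x nMx); [exact: Im|exact: Im'].
Qed.

Lemma module_bigcup_pointed F c :
  (forall M, F M -> is_module M /\ M c) ->
  is_module ([set c] `|` \bigcup_(M in F) M).
Proof.
move=> modF; apply: (@module_pointed _ c); first by left.
move=> x nUx m [->//|[M FM Mm]]; have [modM Mc] := modF M FM.
by apply: modM => // Mx; apply: nUx; right; exists M.
Qed.

(** If [x] compared differently with [m] and [m'], totality would place [x] between them, and
    convexity would put [x] in [M]. *)
Lemma total_convex_module M : totally_ordered X -> convex M -> is_module M.
Proof.
move=> totX cM x nMx.
suff h m m' : M m -> M m' -> (x <= m -> x <= m') /\ (m <= x -> m' <= x).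
  move=> m m' Mm Mm'; have [h1 h2] := h m m' Mm Mm'.
  by have [h3 h4] := h m' m Mm' Mm; split; apply/idP/idP.
move=> Mm Mm'; split=> le1.
- by case/orP: (totX x m') => // le2; case: nMx; exact: cM le2 le1.
- by case/orP: (totX x m') => // le2; case: nMx; exact: cM le1 le2.
Qed.

Lemma equality_ordered_module M : equality_ordered X -> is_module M.
Proof.
move=> eqX x nMx m m' Mm Mm'.
have F k : M k -> (x <= k) = false /\ (k <= x) = false.
  by move=> Mk; split; apply/negP => /eqX E; apply: nMx; rewrite ?E // -E.
by have [[-> ->] [-> ->]] := (F m Mm, F m' Mm').
Qed.

End Modules.

(** * Strong subgroups, generated subgroups and the complete lattice of subgroup-modules *)

Section SubgroupModules.
Context {d : Order.disp_t} {G : orderedGroupType d}.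
Implicit Types (K M : set G) (F : set (set G)) (x y g : G).

Lemma least_strong_in H g : least_strong_module 1 g = H -> H g.
Proof. by move=> <-; apply: sub_gen_smallest; right. Qed.

Lemma least_strong_min {L g} : Vset G L -> L g -> least_strong_module 1 g `<=` L.
Proof.
move=> VL Lg; apply: smallest_sub; first exact: Vset_strong.
by move=> x [->|->] //; exact: Vset1.
Qed.

Lemma Vset_module {H} : Vset G H -> is_module H.
Proof. by case/Vset_strong. Qed.

(** [H] is strong, and the common element [1] excludes disjointness. *)
Lemma Vset_module_comparable {H K} : Vset G H -> is_module K -> K 1 ->
  K `<=` H \/ H `<=` K.
Proof.
move=> VH modK K1; have [_ _ /(_ _ modK)[KH0|KH|HK]] := Vset_strong VH.
- have : (K `&` H) 1 by split=> //; exact: Vset1.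
  by rewrite KH0.
- by left.
- by right.
Qed.

Lemma Vminus_module {H} : is_module (Vminus H : set G).
Proof.
apply: module_bigcup_pointed => L [VL _].
by split; [exact: Vset_module|exact: Vset1].
Qed.

Lemma initial_segment_module (I : set (set G)) : initial_segment I ->
  is_module ([set 1] `|` \bigcup_(H in I) H).
Proof.
move=> [IV _]; apply: module_bigcup_pointed => L /IV VL.
by split; [exact: Vset_module|exact: Vset1].
Qed.

Lemma subgroup_setT : is_subgroup (setT : set G).
Proof. by []. Qed.

Lemma subgroup_bigcap {F} : (forall K, F K -> is_subgroup K) ->
  is_subgroup (\bigcap_(K in F) K).
Proof.
move=> sF; split.
- by move=> K /sF[].
- by move=> x y Ix Iy K FK; have [_ + _] := sF K FK; apply; [exact: Ix|exact: Iy].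
- by move=> x Ix K FK; have [_ _ +] := sF K FK; apply; exact: Ix.
Qed.

Lemma smallest_subgroup (A : set G) : is_subgroup (smallest is_subgroup A).
Proof. by apply: subgroup_bigcap => K []. Qed.

(* For [x] outside the generated subgroup [J] and [m] in [J], [m^-1 * x] is
   outside [J], so a right factor from a generating module can be dropped from
   [m] without affecting comparisons with [x]. *)
Lemma smallest_subgroup_module F : (forall K, F K -> is_subgroup_module K) ->
  is_module (smallest is_subgroup (\bigcup_(K in F) K)).
Proof.
move=> modF; set J := smallest _ _.
have [J1 JM JV] : is_subgroup J by exact: smallest_subgroup.
pose T : set G := [set y | J y /\ forall x m, ~ J x -> J m ->
  (x <= m * y) = (x <= m) /\ (m * y <= x) = (m <= x)].
(* By minimality of [J] it is enough that [T] is a subgroup containing the generators. Letting [m]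
   range over all of [J] gives closure: a product [y * z] is treated by replacing [m] with [m * y],
   an inverse by replacing [m] with [m * y^-1]. *)
have JT : J `<=` T.
  apply: smallest_sub.
    split.
    - by split=> // x m _ _; rewrite mulg1.
    - move=> y z [Jy Ty] [Jz Tz]; split; first exact: JM.
      move=> x m nJx Jm; rewrite mulgA.
      by have [-> ->] := Tz x (m * y) nJx (JM _ _ Jm Jy); exact: Ty.
    - move=> y [Jy Ty]; split; first exact: JV.
      move=> x m nJx Jm.
      by have [] := Ty x (m * y^-1) nJx (JM _ _ Jm (JV _ Jy)); rewrite mulgVK.
  move=> y [K FK Ky]; have KJ : K `<=` J.
    by move=> z Kz; apply: sub_gen_smallest; exists K.
  split; first exact: KJ.
  move=> x m nJx Jm; have [[K1 _ _] modK] := modF K FK.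
  have nK : ~ K (m^-1 * x).
    by move=> /KJ /(JM _ _ Jm); rewrite mulVKg.
  have [E1 E2] := modK _ nK y 1 Ky K1.
  have lx z : (x <= m * z) = (m^-1 * x <= z).
    by rewrite -(le_mulg2l m^-1) mulKg.
  have xl z : (m * z <= x) = (z <= m^-1 * x).
    by rewrite -(le_mulg2l m^-1) mulKg.
  by rewrite lx xl E1 E2 -lx -xl mulg1.
apply: (@module_pointed _ _ _ 1) => // x nJx y /JT[_ Ty].
by have := Ty x 1 nJx J1; rewrite mul1g.
Qed.

Lemma subgroup_family_leE {A : set (Subgroups G)} (K L : A) :
  (K <= L) = `[< val (val K) `<=` val (val L) >].
Proof. by []. Qed.

(** Joins of subgroups are generated subgroups and meets are intersections; both constructions
    preserve modules. The empty family yields the trivial subgroup and [G]. *)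
Lemma MSub_complete_sublattice : complete_sublattice (MSub G).
Proof.
move=> A AM; pose F : set (set G) := [set val K | K in A].
have subF K : F K -> is_subgroup K by move=> [L _ <-]; exact: set_mem (valP L).
have modF K : F K -> is_module K by move=> [L /AM + <-].
split.
- pose J : Subgroups G := exist _ (smallest is_subgroup (\bigcup_(K in F) K))
    (mem_set (smallest_subgroup _)).
  exists J; last first.
    by apply: smallest_subgroup_module => K FK; split; [exact: subF|exact: modF].
  split=> [K AK|L uL]; apply/asboolP.
    by move=> x Kx; apply: sub_gen_smallest; exists (val K) => //; exists K.
  apply: smallest_sub; first exact: set_mem (valP L).
  by move=> x [_ [K AK <-] Kx]; have /asboolP := uL K AK; apply.
- pose J : Subgroups G := exist _ (\bigcap_(K in F) K)
    (mem_set (subgroup_bigcap subF)).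
  exists J; last exact: module_bigcap.
  split=> [K AK|L lL]; apply/asboolP.
    by move=> x; apply; exists K.
  by move=> x Lx _ [K AK <-]; have /asboolP := lL K AK; apply.
Qed.

End SubgroupModules.

(** * Correspondence between subgroup-modules of the quotient and those of the interval *)

Section Correspondence.
Context {d : Order.disp_t} {G : orderedGroupType d} (H : Vset G).
Implicit Types (K L : set G) (x y : G) (P : set (factor H)).

Notation N := (Vminus (val H)).

Let VH : Vset G (val H) := set_mem (valP H).

Lemma factor_proj_eqP {x y} {Hx : val H x} {Hy : val H y} :
  factor_proj Hx = factor_proj Hy <-> N (y^-1 * x).
Proof.
have [N1 NM NV] := Vminus_subgroup VH.
split=> [/(congr1 (fun q => coset_of q x)) /= E|Nyx].
  have : coset (val H) y x by rewrite -E; exact: coset_id.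
  by move=> [n Nn <-]; rewrite mulKg.
apply: factor_inj; apply/seteqP; split=> _ [n Nn <-].
  by exists (y^-1 * x * n); [exact: NM|rewrite !mulgA mulgV mul1g].
exists ((y^-1 * x)^-1 * n); first by apply: NM => //; exact: NV.
by rewrite invgM invgK !mulgA mulgV mul1g.
Qed.

Lemma factor_projE_le {x y} (Hx : val H x) (Hy : val H y) :
  factor_proj Hx != factor_proj Hy ->
  (factor_proj Hx <= factor_proj Hy) = (x <= y).
Proof.
have [N1 NM NV] := Vminus_subgroup VH.
move=> /eqP xy; have nN : ~ N (y^-1 * x) by move=> /factor_proj_eqP /xy.
apply/idP/idP => [/factor_leP[n Nn xyn]|xy'].
  (* After left translation by [y^-1], the point [y^-1 * x] lies outside the module [N], so it
     compares with [n] as it does with [1]. *)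
  have [E _] := Vminus_module _ nN 1 n N1 Nn.
  by rewrite -(le_mulg2l y^-1) mulVg E -(le_mulg2l y) mulVKg.
by apply/factor_leP; exists 1; rewrite ?mulg1.
Qed.

(** A subgroup [K] containing [N] is a union of cosets of [N], so membership does not depend on the
    representative. *)
Lemma factor_image_proj {K x} (Hx : val H x) :
  is_subgroup K -> N `<=` K -> K `<=` val H ->
  factor_image H K (factor_proj Hx) <-> K x.
Proof.
move=> [_ KM _] NK KH; split=> [[y Ky E]|Kx]; last by exists x.
have Hy := KH _ Ky; have /factor_proj_eqP : factor_proj Hx = factor_proj Hy.
  exact: factor_inj.
by move=> /NK /(KM _ _ Ky); rewrite mulVKg.
Qed.

Lemma factor_image_subgroup {K} : is_subgroup K -> N `<=` K -> K `<=` val H ->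
  is_subgroup (factor_image H K).
Proof.
move=> sK NK KH; have [K1 KM KV] := sK; split.
- by apply/(factor_image_proj (Vset_val1 H)).
- move=> q r; have [[x [Hx ->]] [y [Hy ->]]] := (factor_projP q, factor_projP r).
  move=> /factor_image_proj Kx /factor_image_proj Ky.
  rewrite [_ * _]factor_projM; apply/factor_image_proj => //.
  by apply: KM; [exact: Kx|exact: Ky].
- move=> q; have [x [Hx ->]] := factor_projP q.
  move=> /factor_image_proj Kx; rewrite [_^-1]factor_projV.
  by apply/factor_image_proj => //; apply: KV; exact: Kx.
Qed.

Lemma factor_image_module {K} : is_subgroup K -> N `<=` K -> K `<=` val H ->
  is_module (factor_image H K) <-> is_module K.
Proof.
move=> sK NK KH.
(* A point outside [K] and a point of [K] lie in distinct cosets, so comparing the cosets amounts to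
   comparing the points. *)
have cmp x k (Hx : val H x) (Hk : val H k) : ~ K x -> K k ->
    (factor_proj Hx <= factor_proj Hk) = (x <= k) /\
    (factor_proj Hk <= factor_proj Hx) = (k <= x).
  move=> nKx Kk; have xk : factor_proj Hx != factor_proj Hk.
    apply/eqP => E; apply: nKx; apply/(factor_image_proj Hx) => //.
    by rewrite E; apply/factor_image_proj.
  by rewrite !factor_projE_le // eq_sym.
split=> modK.
- move=> x nKx k k' Kk Kk'; have [Hk Hk'] := (KH _ Kk, KH _ Kk').
  (* The quotient says nothing about points outside [H]; for these, [H] itself being a module
     settles the comparison. *)
  have [Hx|nHx] := pselect (val H x); last exact: Vset_module VH _ nHx _ _ Hk Hk'.
  have [<- <-] := cmp _ _ Hx Hk nKx Kk; have [<- <-] := cmp _ _ Hx Hk' nKx Kk'.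
  by apply: modK; [move=> /factor_image_proj; auto|apply/factor_image_proj..].
- move=> p; have [x [Hx ->]] := factor_projP p.
  move=> nKx q r; have [[k [Hk ->]] [k' [Hk' ->]]] := (factor_projP q, factor_projP r).
  move=> /(factor_image_proj _ sK NK KH) Kk /(factor_image_proj _ sK NK KH) Kk'.
  have {}nKx : ~ K x by move=> Kx; apply: nKx; apply/factor_image_proj.
  have [-> ->] := cmp _ _ Hx Hk nKx Kk; have [-> ->] := cmp _ _ Hx Hk' nKx Kk'.
  exact: modK.
Qed.

(** The existential supplies the membership proof on which [factor_proj] depends; proof irrelevance
    makes its choice immaterial. *)
Definition factor_preimage P : set G :=
  [set x | exists Hx : val H x, P (factor_proj Hx)].

Lemma factor_preimage_proj {P x} (Hx : val H x) :
  factor_preimage P x <-> P (factor_proj Hx).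
Proof.
split=> [[Hx']|Px]; last by exists Hx.
by rewrite (Prop_irrelevance Hx' Hx).
Qed.

Lemma factor_preimage_sub P : factor_preimage P `<=` val H.
Proof. by move=> x []. Qed.

Lemma factor_preimage_subgroup {P} : is_subgroup P ->
  is_subgroup (factor_preimage P).
Proof.
move=> [P1 PM PV]; split.
- by exists (Vset_val1 H).
- move=> x y [Hx Px] [Hy Py]; exists (Vset_valM Hx Hy).
  by rewrite -factor_projM; exact: PM.
- by move=> x [Hx Px]; exists (Vset_valV Hx); rewrite -factor_projV; exact: PV.
Qed.

Lemma Vminus_sub_factor_preimage {P} : is_subgroup P -> N `<=` factor_preimage P.
Proof.
move=> [P1 _ _] x Nx; have Hx := Vminus_sub VH Nx; exists Hx.
have -> // : factor_proj Hx = 1.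
by apply/factor_proj_eqP; rewrite invg1 mul1g.
Qed.

Lemma factor_preimageK {P} : is_subgroup P ->
  factor_image H (factor_preimage P) = P.
Proof.
move=> sP; apply/seteqP; split=> q; have [x [Hx ->]] := factor_projP q.
  move=> /factor_image_proj => /(_ (factor_preimage_subgroup sP)).
  move=> /(_ (Vminus_sub_factor_preimage sP) (@factor_preimage_sub P)).
  by move=> /(factor_preimage_proj Hx).
move=> Px; apply/factor_image_proj; [exact: factor_preimage_subgroup
  |exact: Vminus_sub_factor_preimage|exact: factor_preimage_sub|by exists Hx].
Qed.

Lemma factor_imageK {K} : is_subgroup K -> N `<=` K -> K `<=` val H ->
  factor_preimage (factor_image H K) = K.
Proof.
move=> sK NK KH; apply/seteqP; split=> x.
  by move=> [Hx /factor_image_proj]; apply.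
by move=> Kx; exists (KH _ Kx); apply/factor_image_proj.
Qed.

Lemma factor_image_le {K L} : is_subgroup K -> N `<=` K -> K `<=` val H ->
  is_subgroup L -> N `<=` L -> L `<=` val H ->
  factor_image H K `<=` factor_image H L <-> K `<=` L.
Proof.
move=> sK NK KH sL NL LH; split=> KL.
  by rewrite -(factor_imageK sK NK KH) -(factor_imageK sL NL LH) => x [Hx /KL];
    exists Hx.
by move=> q [x /KL Lx E]; exists x.
Qed.

(** The correspondence theorem for subgroups, restricted to modules: image and preimage are mutually
    inverse, respect inclusion and preserve modules. *)
Lemma MSub_interval_iso_MSub :
  poset_iso (MSub_interval (val H)) (MSub (factor H)).
Proof.
have inI (K : MSub_interval (val H)) : [/\ is_subgroup (val (val K)),
    is_module (val (val K)), N `<=` val (val K) & val (val K) `<=` val H].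
  by have [mK NK KH] := set_mem (valP K); split=> //; exact: set_mem (valP (val K)).
have inM (P : MSub (factor H)) :
    is_subgroup (val (val P)) /\ is_module (val (val P)).
  by split; [exact: set_mem (valP (val P))|exact: set_mem (valP P)].
have fS (K : MSub_interval (val H)) :
      is_subgroup (factor_image H (val (val K))).
  by have [sK mK NK KH] := inI K; exact: factor_image_subgroup.
pose f0 (K : MSub_interval (val H)) : Subgroups (factor H) :=
  exist _ (factor_image H (val (val K))) (mem_set (fS K)).
have fM (K : MSub_interval (val H)) : MSub (factor H) (f0 K).
  by have [sK mK NK KH] := inI K; apply/factor_image_module.
pose f (K : MSub_interval (val H)) : MSub (factor H) :=
  exist _ (f0 K) (mem_set (fM K)).
have gS (P : MSub (factor H)) : is_subgroup (factor_preimage (val (val P))).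
  by have [sP _] := inM P; exact: factor_preimage_subgroup.
pose g0 (P : MSub (factor H)) : Subgroups G :=
  exist _ (factor_preimage (val (val P))) (mem_set (gS P)).
have gM (P : MSub (factor H)) : MSub_interval (val H) (g0 P).
  have [sP mP] := inM P; have NP := Vminus_sub_factor_preimage sP.
  have PH := @factor_preimage_sub (val (val P)).
  split=> //; apply/(factor_image_module _ NP PH); first exact: gS.
  by rewrite factor_preimageK.
pose g (P : MSub (factor H)) : MSub_interval (val H) :=
  exist _ (g0 P) (mem_set (gM P)).
exists f.
  exists g => [K|P]; do 2!apply: val_inj => /=.
    by have [sK _ NK KH] := inI K; exact: factor_imageK.
  by have [sP _] := inM P; exact: factor_preimageK.
move=> K L; have [[sK _ NK KH] [sL _ NL LH]] := (inI K, inI L).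
by rewrite !subgroup_family_leE; apply: asbool_equiv_eq; exact: factor_image_le.
Qed.

(** Ensures that in the prime case the two trivial subgroups are distinct. *)
Lemma factor_nontrivial : exists q : factor H, q <> 1.
Proof.
have [_ /existsNP[x /not_implyP[Hx nNx]]] := Vminus_proper VH.
exists (factor_proj Hx) => /factor_proj_eqP.
by rewrite invg1 mul1g.
Qed.

End Correspondence.

(** * Composing order isomorphisms *)

Section PosetIso.
Context {d1 d2 d3 : Order.disp_t}.

Lemma poset_iso_trans {X : porderType d1} {Y : porderType d2}
  {Z : porderType d3} : poset_iso X Y -> poset_iso Y Z -> poset_iso X Z.
Proof.
move=> [f bf mf] [g bg mg]; exists (g \o f); first exact: bij_comp.
by move=> x y /=; rewrite mg mf.
Qed.

Lemma poset_iso_setT {X : porderType d1} (A : set X) :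
  A = setT -> poset_iso A X.
Proof.
move=> AT; exists val => //.
have Ax x : x \in A by rewrite AT in_setT.
by exists (fun x => exist _ x (Ax x)) => x //; exact: val_inj.
Qed.

End PosetIso.

(** * Subgroup-modules of prime, totally ordered and equality-ordered groups *)

Section MSubTrichotomy.
Context {d : Order.disp_t} {Q : orderedGroupType d}.

Lemma MSub_prime : (exists q : Q, q <> 1) -> prime_poset Q ->
  poset_iso (MSub Q) bool.
Proof.
move=> [q0 q01] primeQ.
have s1 : is_subgroup [set 1 : Q].
  by split=> // [x y -> ->|x ->]; rewrite ?mulg1 ?invg1.
pose K1 : Subgroups Q := exist _ [set 1 : Q] (mem_set s1).
pose KT : Subgroups Q := exist _ (setT : set Q) (mem_set subgroup_setT).
have m1 : K1 \in MSub Q by apply/mem_set; exact: module_set1.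
have mT : KT \in MSub Q by apply/mem_set; exact: module_setT.
pose g b : MSub Q := if b then exist _ KT mT else exist _ K1 m1.
(* A trivial module containing [1] is the singleton of [1] or the whole group; membership of [q0]
   tells them apart. *)
pose f (K : MSub Q) : bool := `[< val (val K) q0 >].
have gK : cancel g f.
  by case; rewrite /f /=; [apply/asboolP|apply/asboolP => /q01].
have fK : cancel f g.
  move=> K; do 2!apply: val_inj; rewrite /f.
  have [K1' _ _] : is_subgroup (val (val K)) := set_mem (valP (val K)).
  have [E|[x E]|E] := primeQ _ (set_mem (valP K)).
  - by move: K1'; rewrite E.
  - have x1 : 1 = x by move: K1'; rewrite E.
    by rewrite E -x1; case: asboolP.
  - by rewrite E; case: asboolP => // /(_ Logic.I).
have gE b c : (g b <= g c) = (b <= c).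
  rewrite subgroup_family_leE; case: b c => [] [] /=.
  - by rewrite asboolT.
  - by rewrite asboolF // => /(_ q0 Logic.I) /q01.
  - by rewrite asboolT.
  - by rewrite asboolT.
by exists f; [exists g|move=> K L; rewrite -gE !fK].
Qed.

Lemma MSub_total : totally_ordered Q -> MSub Q = ConvSub Q.
Proof.
move=> totQ; apply/seteqP; split=> K; first exact: module_convex.
exact: total_convex_module.
Qed.

Lemma MSub_equality_ordered : equality_ordered Q -> MSub Q = setT.
Proof.
by move=> eqQ; apply/seteqP; split=> // K _; exact: equality_ordered_module.
Qed.

End MSubTrichotomy.

(** * Classification of subgroup-modules *)

Section Characterization.
Context {d : Order.disp_t} {G : orderedGroupType d}.

(** If [H] were strictly below [H'], it would be one of the members united in [Vminus H'], so [K]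
    would lie in [H], hence in [Vminus H'], against strictness. *)
Lemma Vminus_between_inj {H H' : Vset G} {K : set G} :
  Vminus (val H) `<` K -> K `<` val H ->
  Vminus (val H') `<` K -> K `<` val H' -> H = H'.
Proof.
have below (L M : Vset G) : Vminus (val M) `<` K -> K `<` val L ->
    val L `<=` val M -> val L = val M.
  move=> [_ nMK] [KL nLK] LM; apply/seteqP; split=> //.
  apply: contrapT => nML; apply: nMK => x Kx; right; exists (val L).
    by split; [exact: set_mem (valP L)|].
  exact: KL.
move=> NK KH NK' KH'; apply: val_inj.
have [HH'|H'H] := Vset_chain (set_mem (valP H)) (set_mem (valP H')).
- exact: below.
- by symmetry; exact: below.
Qed.

Lemma subgroup_module_cases (K : set G) : is_subgroup K -> is_module K ->
  (exists2 I : set (set G), initial_segment I &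
     K = [set 1] `|` \bigcup_(H in I) H) \/
  (exists H : Vset G, Vminus (val H) `<` K /\ K `<` val H).
Proof.
move=> [K1 _ _] modK; pose I := [set L | Vset G L /\ L `<=` K].
have IK : [set 1] `|` \bigcup_(H in I) H `<=` K.
  by move=> x [->//|[L [_ LK] /LK]].
have [KI|nKI] := pselect (K `<=` [set 1] `|` \bigcup_(H in I) H); [left|right].
  exists I; last by apply/seteqP.
  by split=> [L []//|L H VL [_ HK] LH]; split=> // x /LH /HK.
have /existsNP[g /not_implyP[Kg nIg]] := nKI.
have g1 : g != 1 by apply/eqP => g1; apply: nIg; left.
pose S := least_strong_module 1 g; have VS : Vset G S by exists g.
have Sg : S g by exact: least_strong_in erefl.
have nSK : ~ S `<=` K by move=> SK; apply: nIg; right; exists S.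
have KS : K `<=` S.
  by have [//|/nSK] := Vset_module_comparable VS modK K1.
exists (exist _ S (mem_set VS)); split=> //=.
split=> [x [->//|[L [VL [LS nSL]] Lx]]|KN].
  (* A member [L] strictly below [S] cannot contain [K]: it would contain [g], and hence [S] by
     minimality. The same minimality shows below that [g] is not in [Vminus S]. *)
  have [KL|] := Vset_module_comparable VL modK K1; last by apply.
  by case: nSL; exact: least_strong_min VL (KL _ Kg).
have [g1'|[L [VL [_ nSL]] Lg]] := KN _ Kg.
  by move: g1; rewrite g1' eqxx.
by apply: nSL; exact: least_strong_min.
Qed.

End Characterization.

Theorem theorem1p2 (d : Order.disp_t) (G : orderedGroupType d) :
  [/\ forall K : set G, is_subgroup K ->
        (is_module K <->
          (exists2 I : set (set G), initial_segment I &
             K = [set 1] `|` \bigcup_(H in I) H) \/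
          (exists! H : Vset G,
             [/\ Vminus (val H) `<` K, K `<` val H &
                 is_subgroup_module (factor_image H K)])),
      forall H : Vset G,
        [/\ prime_poset (factor H) ->
              poset_iso (MSub_interval (val H)) bool,
            totally_ordered (factor H) ->
              poset_iso (MSub_interval (val H)) (ConvSub (factor H)) &
            equality_ordered (factor H) ->
              poset_iso (MSub_interval (val H)) (Subgroups (factor H))] &
      complete_sublattice (MSub G)].
Proof.
split; last exact: MSub_complete_sublattice.
- move=> K sK; split=> [modK|[[I sI ->]|[H [[NK KH [_ modQ]] _]]]].
  + have [|[H [NK KH]]] := subgroup_module_cases _ sK modK; [by left|right].
    have [[NK' _] [KH' _]] := (NK, KH); exists H; split.
      split=> //; split; first exact: factor_image_subgroup.
      exact/factor_image_module.
    by move=> H' [NK1 KH1 _]; exact: Vminus_between_inj NK KH NK1 KH1.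
  + exact: initial_segment_module.
  + by have [[NK' _] [KH' _]] := (NK, KH); apply/(factor_image_module H).
(* The interval is first replaced by [MSub (factor H)], which is then computed for each kind of
   order. *)
- move=> H; have iso := MSub_interval_iso_MSub H; split=> hQ.
  + apply: poset_iso_trans iso (MSub_prime _ hQ); exact: factor_nontrivial.
  + by rewrite -MSub_total.
  + exact: poset_iso_trans iso (poset_iso_setT _ (MSub_equality_ordered hQ)).
Qed.
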